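(* Let $X$ be a compact metric ANR (absolute neighborhood retract for metrizable spaces). Then $\operatorname{cat}_g X = \operatorname{cat} X$.
   Context: A subset $A\subset X$ of a topological space $X$ is contractible in $X$ if the inclusion map $A\to X$ is homotopic to a constant map. The Lusternik-Schnirelmann category $\operatorname{cat} X$ is the smallest integer $k$ such that $X=\bigcup_{i=0}^{k}A_i$, where each $A_i$ is an open subset of $X$ contractible in $X$. The general LS-category $\operatorname{cat}_g X$ is the smallest integer $k$ such that $X=\bigcup_{i=0}^{k}A_i$, where each $A_i$ is an arbitrary subset of $X$ contractible in $X$. Each of these is infinite if no such $k$ exists. *)

(* Defs.v *)
From HB Require Import structures.
From mathcomp Require Import all_boot all_order all_algebra.
From mathcomp Require Import all_classical all_reals all_analysis.

Set Implicit Arguments.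
Unset Strict Implicit.
Unset Printing Implicit Defensive.

Import Order.TTheory GRing.Theory Num.Theory.
Import numFieldNormedType.Exports.

Local Open Scope classical_set_scope.
Local Open Scope ring_scope.

(* Only the values of [f], [g] on [A] matter, and [{within _, continuous H}] is
   continuity for the subspace topology of [A * [0, 1]]: this is homotopy of
   the maps [A -> Y] induced by [f] and [g]. *)
Definition homotopic_on (R : realType) (X Y : topologicalType) (A : set X)
    (f g : X -> Y) : Prop :=
  exists H : X * R -> Y,
    [/\ {within A `*` `[0, 1]%classic, continuous H},
        forall x, A x -> H (x, 0) = f x
      & forall x, A x -> H (x, 1) = g x].

Definition contractible_in (R : realType) (X : topologicalType) (A : set X)
    : Prop :=
  exists c : X, homotopic_on R A id (cst c).

(* [k.+1] sets [A_0, ..., A_k], each satisfying [P], cover [X]. *)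
Definition covered_by (X : topologicalType) (P : set X -> Prop) (k : nat)
    : Prop :=
  exists A : 'I_k.+1 -> set X,
    (forall i, P (A i)) /\ \bigcup_i A i = [set: X].

(* [\bar nat] also contains [-oo], which is never the value. *)
Definition least (P : nat -> Prop) : \bar nat :=
  if pselect (exists k, `[< P k >]) is left exP then (ex_minn exP)%:E else +oo%E.

Definition LScat (R : realType) (X : topologicalType) : \bar nat :=
  least (covered_by (fun A : set X => open A /\ contractible_in R A)).

Definition LScat_g (R : realType) (X : topologicalType) : \bar nat :=
  least (covered_by (fun A : set X => contractible_in R A)).

(* The first two conditions say that [i] is a homeomorphism onto its image: the
   topology of [X] is the one induced from [Y] (so [i] is continuous). *)
Definition closed_embedding (X Y : topologicalType) (i : X -> Y) : Prop :=
  [/\ injective i,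
      forall O : set X, open O <-> exists2 V : set Y, open V & i @^-1` V = O
    & closed (range i)].

Definition retract_of (Y : topologicalType) (A U : set Y) : Prop :=
  A `<=` U /\
  exists r : Y -> Y,
    [/\ {within U, continuous r}, r @` U `<=` A & forall y, A y -> r y = y].

Definition neighborhood_retract (Y : topologicalType) (A : set Y) : Prop :=
  exists U : set Y, [/\ open U, A `<=` U & retract_of A U].

(* Absolute neighborhood retract for metrizable spaces; the metrizability of [X]
   itself is not included. *)
Definition is_ANR (R : realType) (X : topologicalType) : Prop :=
  forall (Y : metricType R) (i : X -> Y),
    closed_embedding i -> neighborhood_retract (range i).

(* Main.v *)
(* Embed [X] by Kuratowski's map [x |-> mdist x _], into the convex
   space of functions [X -> R] with the uniform metric; the ANR property gives a
   retraction defined on the [eps]-neighbourhood of the image. If [H] contracts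
   [A] in [X], give each [a] in [A] a radius within which the tracks of [H] vary
   by at most [eps]. For finitely many centres in [A], averaging their tracks
   with bump functions as weights stays in the [eps]-neighbourhood, so the
   retraction turns it into a contraction in [X] of the union of the balls,
   preceded by a straight-line homotopy from the inclusion. By compactness,
   finitely many balls, taken over all the members of a categorical cover,
   still cover [X]; those belonging to one member form the open set that
   replaces it. *)
Require Import Defs.
From HB Require Import structures.
From mathcomp Require Import all_boot all_order all_algebra.
From mathcomp Require Import all_classical all_reals all_analysis.
From mathcomp Require Import ring lra.

Local Open Scope classical_set_scope.

Import Order.TTheory GRing.Theory Num.Theory.
Import numFieldNormedType.Exports.
Local Open Scope ring_scope.

(** * The truncated uniform metric on real functions *)

Definition ufun (R : realType) (T : Type) : Type := T -> R.

Section ufun_metric.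
Context {R : realType} {T : Type}.
Implicit Types f g h : ufun R T.

(* Truncating at [1] makes the distance finite without a boundedness condition. *)
Definition udist f g : R := sup (range (fun z => Num.min 1 `|f z - g z|)).

Lemma udist_ge f g z : Num.min 1 `|f z - g z| <= udist f g.
Proof.
apply: ub_le_sup; last by exists z.
by exists 1 => _ [y _ <-]; rewrite ge_min lexx.
Qed.

Lemma udist_le f g (e : R) : 0 <= e ->
  (forall z, Num.min 1 `|f z - g z| <= e) -> udist f g <= e.
Proof.
move=> e0 fge; have [[z _]|/set0P/negP/negPn/eqP T0] := pselect ([set: T] !=set0).
  by apply: ge_sup; [exists (Num.min 1 `|f z - g z|), z | move=> _ [y _ <-]].
(* For empty [T] the supremum has its default value [0], hence the assumption [0 <= e]. *)
by rewrite /udist T0 image_set0 sup0.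
Qed.

(** Below [1] the truncation is invisible. *)
Lemma udist_lt_pt f g (e : R) z : e <= 1 -> udist f g < e -> `|f z - g z| < e.
Proof.
move=> e1 /(le_lt_trans (udist_ge f g z)).
by rewrite gt_min => /orP[|//]; rewrite ltNge e1.
Qed.

Lemma udistxx f : udist f f = 0.
Proof.
have le0 : udist f f <= 0.
  by apply: udist_le => // z; rewrite subrr normr0 ge_min lexx orbT.
apply/le_anti; rewrite le0 /=.
have [[z _]|/set0P/negP/negPn/eqP T0] := pselect ([set: T] !=set0).
  by apply: le_trans (udist_ge f f z); rewrite le_min ler01 normr_ge0.
by rewrite /udist T0 image_set0 sup0.
Qed.

Lemma udist_eq0 f g : udist f g = 0 -> f = g.
Proof.
move=> fg; apply/funext => z; have := udist_ge f g z.
rewrite fg ge_min leNgt ltr01 /= normr_le0 subr_eq0.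
by move/eqP.
Qed.

Lemma udistC f g : udist f g = udist g f.
Proof.
by rewrite /udist; congr sup; congr image; apply/funext => z; rewrite distrC.
Qed.

Lemma udist_ge0 f g : 0 <= udist f g.
Proof.
have [[z _]|/set0P/negP/negPn/eqP T0] := pselect ([set: T] !=set0).
  by apply: le_trans (udist_ge f g z); rewrite le_min ler01 normr_ge0.
by rewrite /udist T0 image_set0 sup0.
Qed.

Lemma udist_triangle g f h : udist f h <= udist f g + udist g h.
Proof.
apply: udist_le => [|z]; first by rewrite addr_ge0 ?udist_ge0.
apply: le_trans (lerD (udist_ge f g z) (udist_ge g h z)).
have := ler_distD (g z) (f z) (h z).
have := normr_ge0 (f z - g z); have := normr_ge0 (g z - h z).
(* If a term on the right is truncated, the sum is at least [1]; otherwise the usual triangle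
   inequality applies. *)
case: (leP 1 `|f z - g z|); case: (leP 1 `|g z - h z|) => ? ? ? ? ?;
  by rewrite ge_min; apply/orP; first [by left; lra|by right; lra].
Qed.

End ufun_metric.

HB.instance Definition _ (R : realType) (T : Type) :=
  Choice.copy (ufun R T) (T -> R).
HB.instance Definition _ (R : realType) (T : Type) :=
  isMetric.Build R (ufun R T) udistxx udist_eq0 udistC udist_triangle.

Lemma mdist_ufunE (R : realType) (T : Type) (f g : ufun R T) :
  mdist f g = udist f g.
Proof. by []. Qed.

(** Tube lemma: compactness makes joint continuity uniform in the second variable. *)
Lemma ufun_cvg (R : realType) (P X : topologicalType) (F : P -> ufun R X) p :
  compact [set: X] ->
  (forall z, {for (p, z), continuous (fun q => F q.1 q.2)}) ->
  {for p, continuous F}.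
Proof.
move=> /compact_near_coveringP cX cF.
apply/metricType_numDomainType.cvgrPdist_lt => e e0.
(* A supremum of bounds [<= e / 2] is still [< e]; two comparisons with [F p z] cost [e / 4]
   each. *)
pose Q q z := `|F p z - F q z| <= e / 2.
have : \forall q \near p, [set: X] `<=` Q q.
  apply: cX => z _.
  have e4 : 0 < e / 4 by rewrite divr_gt0.
  have := (@cvgr_dist_lt _ _ _ _ _ _ _ (cF z)) _ e4.
  case=> -[U V] /= [pU zV] UV.
  exists (V, U) => //= -[z' q] [/= Vz' Uq].
  have h1 := UV (q, z') (conj Uq Vz').
  have h2 := UV (p, z') (conj (nbhs_singleton pU) Vz').
  rewrite /Q; move: h1 h2 => /=; rewrite distrC => h1 h2.
  have := ler_distD (F p z) (F p z') (F q z').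
  rewrite (distrC (F p z') (F p z)) (distrC (F p z) (F q z')).
  by move=> h3; lra.
apply: filterS => q /= Qq.
rewrite mdist_ufunE (@le_lt_trans _ _ (e / 2)) //; last by lra.
apply: udist_le; first by lra.
by move=> z; rewrite ge_min; apply/orP; right; exact: Qq.
Qed.

Lemma continuous_at_mdist (R : realType) (T : topologicalType)
    (M : metricType R) (f : T -> M) t :
  (forall e, 0 < e -> \forall t' \near t, mdist (f t) (f t') < e) ->
  {for t, continuous f}.
Proof. by move=> fe; apply/metricType_numDomainType.cvgrPdist_lt. Qed.

(** The difference is the weighted mean of the [u j - v], where terms of weight zero drop out. *)
Lemma ler_dist_wmean (R : realFieldType) (J : finType) (w u : J -> R) (v e : R) :
  (forall j, 0 <= w j) -> 0 < \sum_j w j ->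
  (forall j, 0 < w j -> `|u j - v| <= e) ->
  `|(\sum_j w j * u j) / (\sum_j w j) - v| <= e.
Proof.
move=> w0 W0 we; set W := \sum_j w j.
have -> : (\sum_j w j * u j) / W - v = (\sum_j w j * (u j - v)) / W.
  under [in RHS]eq_bigr do rewrite mulrBr.
  by rewrite sumrB -mulr_suml mulrBl [W * v]mulrC mulfK // gt_eqF.
rewrite normrM normfV (gtr0_norm W0) ler_pdivrMr // mulr_sumr.
apply: (le_trans (ler_norm_sum _ _ _)); apply: ler_sum => j _.
rewrite normrM ger0_norm // mulrC; have := w0 j; rewrite le_eqVlt.
by case/predU1P => [<-|wj]; rewrite ?mulr0 // ler_wpM2r // we.
Qed.

(** * The Kuratowski embedding and the retraction onto its image *)

Section kuratowski.
Context {R : realType} {X : metricType R}.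
Implicit Types x y z : X.

Lemma mdist_lipschitz x y z : `|mdist x z - mdist y z| <= mdist x y.
Proof.
have := metric_triangle x y z; have := metric_triangle y x z.
by rewrite (metric_sym y x) ler_norml => ? ?; apply/andP; split; lra.
Qed.

Lemma mdist_continuous : continuous (fun p : X * X => mdist p.1 p.2).
Proof.
move=> [x z]; apply/cvgrPdist_lt => e e0.
have e2 : 0 < e / 2 by lra.
exists (ball x (e / 2), ball z (e / 2)); first by split; exact: nbhsx_ballx.
move=> -[x' z'] /=; rewrite !ballEmdist /= => -[xx' zz'].
have := ler_distD (mdist x' z) (mdist x z) (mdist x' z').
have := mdist_lipschitz x x' z; have := mdist_lipschitz z z' x'.
by rewrite (metric_sym z x') (metric_sym z' x'); lra.
Qed.

Definition kuratowski x : ufun R X := mdist x.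

Lemma kuratowski_le x y : mdist (kuratowski x) (kuratowski y) <= mdist x y.
Proof.
apply: udist_le => [|z]; first exact: mdist_ge0.
by rewrite ge_min mdist_lipschitz orbT.
Qed.

Lemma kuratowski_lt x y (e : R) : e <= 1 ->
  mdist (kuratowski x) (kuratowski y) < e -> mdist x y < e.
Proof.
move=> e1 /(udist_lt_pt _ _ _ y e1); rewrite /kuratowski mdistxx subr0.
by rewrite ger0_norm ?mdist_ge0.
Qed.

Lemma kuratowski_inj : injective kuratowski.
Proof.
move=> x y xy; apply: mdist_positivity.
by rewrite -[mdist x]/(kuratowski x) xy /kuratowski mdistxx.
Qed.

Lemma kuratowski_continuous : continuous kuratowski.
Proof.
move=> x; apply/metricType_numDomainType.cvgrPdist_lt => e e0.
have := nbhsx_ballx x e e0; rewrite ballEmdist; apply: filterS => y /=.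
exact/le_lt_trans/kuratowski_le.
Qed.

Lemma kuratowski_closed_embedding :
  compact [set: X] -> closed_embedding kuratowski.
Proof.
move=> cX; split; first exact: kuratowski_inj.
(* The open set inducing [O] is a union of interiors of balls about image points. Radii are at most
   [1], so that [kuratowski_lt] turns nearness of images into nearness in [X]. *)
- move=> O; split => [oO|[V oV <-]]; last first.
    by apply: open_comp => // x _; exact: kuratowski_continuous.
  pose D := [set p : X * R | [/\ 0 < p.2, p.2 <= 1 & ball p.1 p.2 `<=` O]].
  exists (\bigcup_(p in D) (ball (kuratowski p.1) p.2)°).
    by apply: bigcup_open => p _; exact: open_interior.
  apply/seteqP; split => [y [[x e] /= [e0 e1 xO]] /interior_subset|x Ox].
    rewrite ballEmdist /= => /(kuratowski_lt _ _ _ e1) xy.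
    by apply: xO; rewrite ballEmdist.
  have /nbhs_ballP[e /= e0 xO] := open_nbhs_nbhs (conj oO Ox).
  exists (x, Num.min 1 e) => /=; last first.
    by apply: nbhsx_ballx; rewrite lt_min ltr01.
  split; rewrite /= ?lt_min ?ltr01 ?ge_min ?lexx //.
  by apply: subset_trans xO; apply: le_ball; rewrite ge_min lexx orbT.
- apply: compact_closed; first exact: metric_hausdorff.
  apply: continuous_compact cX.
  by apply: continuous_subspaceT; exact: kuratowski_continuous.
Qed.

(** [rho] is the neighbourhood retraction followed by the inverse of [kuratowski]; compactness gives
    one radius [eps] valid at all points. *)
Lemma ANR_retraction (x0 : X) : compact [set: X] -> is_ANR R X ->
  exists (eps : R) (rho : ufun R X -> X),
    [/\ 0 < eps, forall x, rho (kuratowski x) = x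
      & forall f x, mdist (kuratowski x) f < eps -> {for f, continuous rho}].
Proof.
move=> cX /(_ _ _ (kuratowski_closed_embedding cX)).
move=> [U [oU XU [_ [r [cr rU rX]]]]].
have [eps eps0 epsU] : exists2 eps : R, 0 < eps &
    forall x, ball (kuratowski x) eps `<=` U.
  have := (iffLR (compact_near_coveringP _) cX) _ (0 : R)^'+
    (fun e x => ball (kuratowski x) e `<=` U) _.
  case.
    move=> x _; have Ux : U (kuratowski x) by apply: XU; exists x.
    have /nbhs_ballP[e /= e0 xU] := open_nbhs_nbhs (conj oU Ux).
    exists (ball x (e / 2), [set t | t < e / 2]) => /=.
      by split; [apply: nbhsx_ballx; lra | apply: nbhs_right_lt; lra].
    move=> -[y t] /= [xy te] f yf; apply: xU.
    apply: (@ball_split _ _ (kuratowski y)).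
      rewrite ballEmdist /=; apply: (le_lt_trans (kuratowski_le _ _)).
      by move: xy; rewrite ballEmdist.
    exact: le_ball (ltW te) _ yf.
  move=> d /= d0 dU; exists (d / 2); first by lra.
  move=> x; apply: dU => //=; last by lra.
  by rewrite sub0r normrN gtr0_norm; lra.
(* The default [x0] is taken only where [r f] misses the image, which cannot happen on [U]. *)
pose rho f := xget x0 [set x | kuratowski x = r f].
have rhoE f : U f -> kuratowski (rho f) = r f.
  move=> Uf; have [x _ xf] : range kuratowski (r f) by apply: rU; exists f.
  rewrite /rho; case: xgetP => [y _ //|/(_ x)]; by rewrite /= xf.
exists eps, rho; split => // [x|f x xf].
  have kx : range kuratowski (kuratowski x) by exists x.
  by apply: kuratowski_inj; rewrite rhoE ?rX //; exact: XU.
have Uf : U f by apply: (epsU x); rewrite ballEmdist.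
have crf := iffLR (subspace_continuousP _ _) cr f Uf.
apply: continuous_at_mdist => e e0.
(* The cap at [1] is what [kuratowski_lt] requires to pass from [r] back to [rho]. *)
have e1 : 0 < Num.min 1 e by rewrite lt_min ltr01.
have nf : \forall g \near f, U g -> mdist (r f) (r g) < Num.min 1 e :=
  metricType_numDomainType.cvgr_dist_lt (FF := within_filter _ (nbhs_filter f)) crf e1.
have nU : \forall g \near f, U g := open_nbhs_nbhs (conj oU Uf).
near=> g; have Ug : U g by near: g.
have rfg := near nf g.
have : mdist (r f) (r g) < Num.min 1 e by apply: rfg.
rewrite -!rhoE // => /kuratowski_lt.
by rewrite ge_min lexx lt_min => /(_ isT)/andP[].
Unshelve. all: by end_near. Qed.

End kuratowski.

(** * Continuous blending of finitely many tracks *)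

Lemma continuous_at_comp2 (T U V W : topologicalType) (h : U * V -> W)
    (f : T -> U) (g : T -> V) t :
  {for t, continuous f} -> {for t, continuous g} -> continuous h ->
  {for t, continuous (fun s => h (f s, g s))}.
Proof.
move=> cf cg ch; apply: (continuous_comp (f := fun s => (f s, g s))); last exact: ch.
exact: cvg_pair.
Qed.

Lemma continuous_at_sum (R : realType) (T : topologicalType) (J : finType)
    (f : J -> T -> R) t :
  (forall j, {for t, continuous (f j)}) ->
  {for t, continuous (fun s => \sum_j f j s)}.
Proof.
move=> cf; apply: cvg_big => [|j _]; last exact: cf.
exact: add_continuous.
Qed.

Section blend.
Context {R : realType} {X : metricType R}.
Variables (H : X * R -> X) (delta : X -> R) (J : finType) (a : J -> X).
Implicit Types (x z : X) (t : R) (j : J).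

Definition bump j x := Num.max 0 (delta (a j) - mdist (a j) x).

(** On [[0, 1/2]] the weight grows from [0] to [1] while [blend_time] rests at [0]; on [[1/2, 1]]
    the weight rests at [1] while the time runs from [0] to [1]. *)
Definition blend_weight t := Num.min 1 (2 * t).

(** Clamping on both sides makes tracks defined over [[0, 1]] continuous on the whole line. *)
Definition blend_time t := Num.max 0 (Num.min 1 (2 * t - 1)).

Definition blend (q : X * R) : ufun R X := fun z =>
  (1 - blend_weight q.2) * mdist q.1 z + blend_weight q.2 *
  ((\sum_j bump j q.1 * mdist (H (a j, blend_time q.2)) z) / \sum_j bump j q.1).

Lemma bump_ge0 j x : 0 <= bump j x.
Proof. by rewrite /bump le_max lexx. Qed.

Lemma bump_gt0 j x : (0 < bump j x) = (mdist (a j) x < delta (a j)).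
Proof. by rewrite /bump lt_max ltxx subr_gt0. Qed.

Lemma sum_bump_gt0 j x : mdist (a j) x < delta (a j) -> 0 < \sum_j bump j x.
Proof.
rewrite -bump_gt0 => jx; rewrite (bigD1 j) //= ltr_wpDr // sumr_ge0 // => k _.
exact: bump_ge0.
Qed.

Lemma blend_weight_continuous : continuous blend_weight.
Proof.
move=> t; apply: continuous_min; first exact: cvg_cst.
by apply: continuousM; [exact: cvg_cst|exact: cvg_id].
Qed.

Lemma blend_time_continuous : continuous blend_time.
Proof.
move=> t; apply: (continuous_max (f := cst 0)
  (g := fun t => Num.min 1 (2 * t - 1))); first exact: cvg_cst.
apply: continuous_min; first exact: cvg_cst.
apply: continuousB; last exact: cvg_cst.
by apply: continuousM; [exact: cvg_cst|exact: cvg_id].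
Qed.

Lemma blend_time_itv t : 0 <= blend_time t <= 1.
Proof. by rewrite /blend_time le_max lexx ge_max ler01 ge_min lexx. Qed.

Lemma bump_continuous j : continuous (bump j).
Proof.
move=> x; apply: (continuous_max (f := cst 0)
  (g := fun y => delta (a j) - mdist (a j) y)); first exact: cvg_cst.
apply: continuousB; first exact: cvg_cst.
by apply: (continuous_at_comp2 _ _ _ _ _ _ _ _ _ _ mdist_continuous);
  [exact: cvg_cst|exact: cvg_id].
Qed.

(** By [ufun_cvg] it suffices that the values are jointly continuous in point, time and argument. *)
Lemma blend_continuous x t : compact [set: X] -> 0 < \sum_j bump j x ->
  (forall j, {for t, continuous (fun t => H (a j, blend_time t))}) ->
  {for (x, t), continuous blend}.
Proof.
move=> cX W0 cH; apply: ufun_cvg => // z.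
have c1 : {for ((x, t), z), continuous (fun q : X * R * X => q.1.1)}.
  by apply: (continuous_comp (f := fst) (g := fst)); exact: cvg_fst.
have c2 : {for ((x, t), z), continuous (fun q : X * R * X => q.1.2)}.
  by apply: (continuous_comp (f := fst) (g := snd)); [exact: cvg_fst|exact: cvg_snd].
have cz : {for ((x, t), z), continuous (fun q : X * R * X => q.2)}.
  exact: cvg_snd.
have cw : {for ((x, t), z), continuous (fun q : X * R * X => blend_weight q.1.2)}.
  by apply: (continuous_comp (g := blend_weight) c2); exact: blend_weight_continuous.
have cb j : {for ((x, t), z), continuous (fun q : X * R * X => bump j q.1.1)}.
  by apply: (continuous_comp (g := bump j) c1); exact: bump_continuous.
have cp j : {for ((x, t), z),
    continuous (fun q : X * R * X => H (a j, blend_time q.1.2))}.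
  by apply: (continuous_comp (g := fun t => H (a j, blend_time t)) c2); exact: cH.
apply: continuousD; apply: continuousM.
- by apply: continuousB => //; exact: cvg_cst.
- exact: (continuous_at_comp2 _ _ _ _ _ _ _ _ c1 cz mdist_continuous).
- exact: cw.
- apply: continuousM.
    apply: continuous_at_sum => j; apply: continuousM => //.
    exact: (continuous_at_comp2 _ _ _ _ _ _ _ _ (cp j) cz mdist_continuous).
  by apply: continuousV; [rewrite gt_eqF|exact: continuous_at_sum].
Qed.

Lemma blend0 x : blend (x, 0) = kuratowski x.
Proof.
apply/funext => z; rewrite /blend /blend_weight /= mulr0.
by rewrite min_r ?ler01 // subr0 mul1r mul0r addr0.
Qed.

Lemma blend1 x c : 0 < \sum_j bump j x -> (forall j, H (a j, 1) = c) ->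
  blend (x, 1) = kuratowski c.
Proof.
move=> W0 Hc; apply/funext => z; rewrite /blend /blend_weight /blend_time /=.
rewrite (_ : 2 * 1 - 1 = 1 :> R); last by lra.
rewrite minxx max_r ?ler01 // min_l; last by lra.
rewrite subrr mul0r add0r mul1r.
under eq_bigr do rewrite Hc.
by rewrite -mulr_suml mulrC mulrA mulVf ?mul1r // gt_eqF.
Qed.

(* For [t <= 1/2] the blend stays near [x], the centres of the active bumps being
   [eps]-close to [x]; for [t >= 1/2] it stays near the track of the active
   centre [a j0] of largest radius, whose ball of radius [2 * delta (a j0)]
   contains all the other active centres. *)
Lemma blend_near_kuratowski (eps : R) x t j :
  (forall j, delta (a j) <= eps) -> (forall j, H (a j, 0) = a j) ->
  (forall j k s, 0 <= s <= 1 -> mdist (a j) (a k) < 2 * delta (a j) ->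
    mdist (H (a j, s)) (H (a k, s)) <= eps) ->
  mdist (a j) x < delta (a j) -> 0 <= t ->
  exists y, mdist (kuratowski y) (blend (x, t)) <= eps.
Proof.
move=> deps H0 Heps jx t0; have W0 := sum_bump_gt0 j x jx.
have eps0 : 0 <= eps.
  by apply: le_trans (deps j); apply: le_trans (ltW jx); exact: mdist_ge0.
have [t2|t2] := leP (2 * t) 1.
  have s0 : blend_time t = 0.
    by rewrite /blend_time min_r ?max_l //; lra.
  exists x; apply: udist_le => // z; rewrite ge_min; apply/orP; right.
  rewrite /blend /blend_weight s0 min_r //= /kuratowski.
  set m := ((\sum_j _) / _).
  have mx : `|m - mdist x z| <= eps.
    apply: ler_dist_wmean => // [k|k]; first exact: bump_ge0.
    rewrite bump_gt0 H0 => kx; apply: le_trans (mdist_lipschitz _ _ _) _.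
    exact: le_trans (ltW kx) (deps k).
  have -> : mdist x z - ((1 - 2 * t) * mdist x z + 2 * t * m) =
    - (2 * t * (m - mdist x z)) by ring.
  rewrite normrN normrM ger0_norm; last by lra.
  apply: le_trans mx; rewrite ler_piMl //; lra.
pose P := [pred k | mdist (a k) x < delta (a k)].
have [|j0 j0x j0max] := @arg_maxP _ _ _ j P (fun k => delta (a k)).
  exact: jx.
exists (H (a j0, blend_time t)); apply: udist_le => // z.
rewrite ge_min; apply/orP; right; rewrite distrC /blend /blend_weight.
rewrite min_l ?(ltW t2) //= subrr mul0r add0r mul1r.
apply: ler_dist_wmean => // [k|k]; first exact: bump_ge0.
rewrite bump_gt0 => kx; apply: le_trans (mdist_lipschitz _ _ _) _.
rewrite metric_sym; apply: Heps; first exact: blend_time_itv.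
have := metric_triangle (a j0) x (a k); rewrite (metric_sym x).
by have := j0max k kx; move: j0x kx => /=; lra.
Qed.

End blend.

(** * Thickening a contractible set *)

Lemma ball_mdist_open (R : realType) (X : metricType R) (x : X) (e : R) :
  open (ball x e).
Proof.
rewrite ballEmdist; apply: (@open_comp _ _ (mdist x) [set r | r < e]).
  move=> y _; exact: (continuous_at_comp2 _ _ _ _ _ _ _ _ (cvg_cst x) cvg_id
    mdist_continuous).
exact: open_lt.
Qed.

Section thickening.
Context {R : realType} {X : metricType R}.
Variables (A : set X) (H : X * R -> X).
Hypothesis cH : {within A `*` `[0, 1]%classic, continuous H}.

Let cH_mdist (a : X) (t e : R) : A a -> 0 <= t <= 1 -> 0 < e ->
  \forall q \near (a, t), A q.1 -> 0 <= q.2 <= 1 -> mdist (H (a, t)) (H q) < e.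
Proof.
move=> Aa t01 e0.
have Iat : (A `*` `[0, 1]%classic) (a, t) by split; rewrite //= in_itv.
have cHat := iffLR (subspace_continuousP _ _) cH _ Iat.
have : \forall q \near (a, t), (A `*` `[0, 1]%classic) q ->
    mdist (H (a, t)) (H q) < e := metricType_numDomainType.cvgr_dist_lt
    (FF := within_filter _ (nbhs_filter (a, t))) cHat e0.
apply: filterS => -[x s] /= Hxs Ax s01; exact: Hxs.
Qed.

Lemma track_continuous a : A a -> continuous (fun t => H (a, blend_time t)).
Proof.
move=> Aa t; apply: continuous_at_mdist => e e0.
have := cH_mdist _ _ _ Aa (blend_time_itv t) e0.
case=> -[U V] /= [aU tV] UV.
have : \forall s \near t, V (blend_time s) := blend_time_continuous t _ tV.
apply: filterS => s Vs; apply: (UV (a, blend_time s)) => //.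
  by split => //; exact: nbhs_singleton.
exact: blend_time_itv.
Qed.

(** Compactness of [[0, 1]] makes the radius independent of time. The factor [2] matches the
    distance between active centres in [blend_near_kuratowski]. *)
Lemma track_radius (eps : R) a : 0 < eps -> exists d : R, [/\ 0 < d, d <= eps &
  A a -> forall x t, A x -> 0 <= t <= 1 -> mdist a x < 2 * d ->
    mdist (H (a, t)) (H (x, t)) <= eps].
Proof.
move=> eps0; have [Aa|nAa] := pselect (A a); last by exists eps.
have : \forall x \near a, `[0, 1]%classic `<=`
    (fun t => A x -> mdist (H (a, t)) (H (x, t)) <= eps).
  apply: (iffRL (near_covering_withinP _)
    (iffLR (compact_near_coveringP _) (@segment_compact R 0 1))) => t.
  rewrite /= in_itv /= => t01; have e2 : 0 < eps / 2 by lra.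
  case: (cH_mdist _ _ _ Aa t01 e2) => -[U V] /= [aU tV] UV.
  exists (V, U) => // -[s x] /= [Vs Ux]; rewrite in_itv /= => s01 Ax.
  have := UV (x, s) (conj Ux Vs) Ax s01.
  have := UV (a, s) (conj (nbhs_singleton aU) Vs) Aa s01.
  have := metric_triangle (H (a, s)) (H (a, t)) (H (x, s)).
  by rewrite (metric_sym (H (a, s)) (H (a, t))); lra.
move=> /nbhs_ballP[d /= d0 ad]; exists (Num.min eps (d / 2)); split.
- by rewrite lt_min eps0; lra.
- by rewrite ge_min lexx.
- move=> _ x t Ax t01 ax; apply: ad => //.
  rewrite ballEmdist /=; apply: (lt_le_trans ax).
  have : Num.min eps (d / 2) <= d / 2 by rewrite ge_min lexx orbT.
  by lra.
Qed.

End thickening.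

(* The radii depend only on [A], not on the finite family of centres. *)
Lemma contractible_thickening (R : realType) (X : metricType R) (A : set X) :
  compact [set: X] -> is_ANR R X -> contractible_in R A ->
  exists delta : X -> R, (forall a, 0 < delta a) /\
    forall (J : finType) (a : J -> X), (forall j, A (a j)) ->
      contractible_in R (\bigcup_j ball (a j) (delta (a j))).
Proof.
move=> cX aX [c [H [cH H0 H1]]].
have [eps [rho [eps0 rhoK crho]]] := ANR_retraction c cX aX.
(* The bounds on the blend are not strict, while continuity of [rho] needs distance [< eps]. *)
have e2 : 0 < eps / 2 by lra.
have [delta deltaP] := choice (fun a => track_radius _ _ cH _ a e2).
exists delta; split => [a|J a Aa]; first by case: (deltaP a).
exists c, (rho \o blend H delta J a).
have Ux x : (\bigcup_j ball (a j) (delta (a j))) x ->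
    exists j, mdist (a j) x < delta (a j).
  by case=> j _; rewrite ballEmdist; exists j.
split.
- apply: continuous_in_subspaceT => -[x t] /set_mem [/= /Ux[j jx]].
  rewrite in_itv /= => /andP[t0 t1].
  have [|||||y yxt] := blend_near_kuratowski H delta J a (eps / 2) x t j.
  + by move=> k; case: (deltaP (a k)).
  + by move=> k; exact: H0.
  + move=> k l s s01 kl; case: (deltaP (a k)) => _ _; exact.
  + exact: jx.
  + exact: t0.
  apply: continuous_comp.
    apply: blend_continuous => //; first exact: sum_bump_gt0 jx.
    by move=> k; exact: (track_continuous _ _ cH _ (Aa k)).
  by apply: crho; apply: (le_lt_trans yxt); lra.
- by move=> x /Ux[j jx] /=; rewrite blend0 rhoK.
- move=> x /Ux[j jx] /=; rewrite (blend1 _ _ _ _ _ c) ?rhoK //.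
    exact: sum_bump_gt0 jx.
  by move=> k; exact: H1.
Qed.

(** * Replacing the members of a cover by open sets *)

Lemma covered_by_open (R : realType) (X : metricType R) (k : nat) :
  compact [set: X] -> is_ANR R X ->
  Defs.covered_by (fun A : set X => contractible_in R A) k ->
  Defs.covered_by (fun A : set X => open A /\ contractible_in R A) k.
Proof.
move=> cX aX [A [cA AT]].
have [delta deltaP] := choice
  (fun i => contractible_thickening _ _ _ cX aX (cA i)).
(* Each centre is paired with the index of a member containing it, since the radius depends on that
   member. *)
pose D := [set p : 'I_k.+1 * X | A p.1 p.2].
pose B (p : 'I_k.+1 * X) := ball p.2 (delta p.1 p.2).
have oB p : D p -> open (B p) by move=> _; exact: ball_mdist_open.
have cB : [set: X] `<=` cover D B.
  move=> x _; have [i _ Aix] : (\bigcup_i A i) x by rewrite AT.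
  by exists (i, x) => //; apply: ballxx; case: (deltaP i).
have [c _] := cA ord0.
(* [compact_cover] is stated for pointed spaces only. *)
pose pX := isPointed.Build (Metric.sort X) c.
pose PX : ptopologicalType := HB.pack (Metric.sort X) pX.
have : compact [set: PX] := cX.
rewrite compact_cover => /(_ _ _ _ oB cB)[D' D'D TD'].
(* Sorting the finite subcover by index keeps the number of sets at [k.+1]; a group may be empty. *)
pose s i := [seq p <- finmap.enum_fset D' | p.1 == i].
pose a i (p : seq_sub (s i)) := (ssval p).2.
exists (fun i => \bigcup_p ball (a i p) (delta i (a i p))); split => [i|].
  split; first by apply: bigcup_open => p _; exact: ball_mdist_open.
  apply: (proj2 (deltaP i)) => p; rewrite /a.
  have := ssvalP p; move: (ssval p) => q.
  by rewrite mem_filter => /andP[/eqP <- /D'D]; rewrite inE.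
apply/seteqP; split => // x _; have [p D'p Bpx] := TD' x I.
have sp : p \in s p.1 by rewrite mem_filter eqxx.
by exists p.1 => //; exists (SeqSub sp).
Qed.

Theorem theorem3p9 (R : realType) (X : metricType R)
    (X_compact : compact [set: X]) (X_ANR : is_ANR R X) :
  LScat_g R X = LScat R X.
Proof.
(* The covering properties agree for every [k], which also settles the infinite case. *)
rewrite /LScat_g /LScat; congr least; apply/funext => k; apply/propext; split.
  exact: covered_by_open.
by move=> [A [cA AT]]; exists A; split => // i; case: (cA i).
Qed.
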